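(* Consider a univariate exponential family of pdfs or pmfs $f(x,\theta)=v(x)\exp(\eta(\theta)u(x)-\zeta(\theta))$, $\theta\in\Theta$, with known functions $u,v,\eta,\zeta$ and $\eta,\zeta$ differentiable. Let $\mu(\theta)=\mathbb{E}_\theta[u(X)]$. Let $X,X_1,\dots,X_n$ be i.i.d. with pdf or pmf $f(\cdot,\theta)$ and $Z=\frac1n\sum_{i=1}^nu(X_i)$. Let $\alpha\in\Theta$ and $z=\mu(\alpha)$. For $\vartheta\in\Theta$ define $\rho(z,\vartheta)=[\eta(\theta)-\eta(\vartheta)]z-\zeta(\theta)+\zeta(\vartheta)$. Let $\mathscr{C}$ be the Berry–Esseen constant and $$\varDelta=\min\Big\{\frac12,\ \frac{\mathscr{C}}{\sqrt n}\,\frac{\mathbb{E}_\alpha[|u(X)-z|^3]}{\mathbb{E}_\alpha^{3/2}[|u(X)-z|^2]}\Big\}.$$ Then: (I) If $\mu(\theta)\le z$ and $\Pr\{u(X)<z\mid\theta\}>0$, then $\Pr\{Z\ge z\mid\theta\}\le\exp(n\rho(z,\alpha))$ and $\lim_{n\to\infty}\frac1n\ln\Pr\{Z\ge z\mid\theta\}=\rho(z,\alpha)$. (II) If $\mu(\theta)\ge z$ and $\Pr\{u(X)>z\mid\theta\}>0$, then $\Pr\{Z\le z\mid\theta\}\le\exp(n\rho(z,\alpha))$ and $\lim_{n\to\infty}\frac1n\ln\Pr\{Z\le z\mid\theta\}=\rho(z,\alpha)$. (III) If $\eta(\theta)\le\eta(\alpha)$, then $\Pr\{Z\ge z\mid\theta\}\le\exp(n\rho(z,\alpha))\Pr\{Z\ge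 z\mid\alpha\}\le(\frac12+\varDelta)\exp(n\rho(z,\alpha))$. (IV) If $\eta(\theta)\ge\eta(\alpha)$, then $\Pr\{Z\le z\mid\theta\}\le\exp(n\rho(z,\alpha))\Pr\{Z\le z\mid\alpha\}\le(\frac12+\varDelta)\exp(n\rho(z,\alpha))$.
   Context: $\mathbb{E}_\alpha$ denotes expectation when $X$ has pdf or pmf $f(\cdot,\alpha)$; $\Pr\{E\mid\theta\}$ is the probability of $E$ when the samples have pdf or pmf $f(\cdot,\theta)$. The Berry–Esseen constant $\mathscr{C}$ is a positive absolute constant such that for every random variable $Y$ with $\mathbb{E}[Y]=0$, $\mathbb{E}[Y^2]>0$, $\mathbb{E}[|Y|^3]<\infty$, every $n$ and every $y\in\mathbb{R}$, $|F_n(y)-\Phi(y)|\le\frac{\mathscr{C}}{\sqrt n}\frac{\mathbb{E}[|Y|^3]}{\mathbb{E}^{3/2}[Y^2]}$, where $F_n$ is the cdf of $\sum_{i=1}^nY_i/\sqrt{n\mathbb{E}[Y^2]}$ for i.i.d. copies $Y_i$ of $Y$ and $\Phi$ is the standard normal cdf. *)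

(* Defs.v *)
From HB Require Import structures.
From mathcomp Require Import all_boot all_order all_algebra.
From mathcomp Require Import all_classical all_reals all_analysis.
Set Implicit Arguments. Unset Strict Implicit. Unset Printing Implicit Defensive.
Import Order.TTheory GRing.Theory Num.Theory.
Import numFieldNormedType.Exports.
Local Open Scope classical_set_scope.
Local Open Scope ring_scope.

Section Defs.
Variable R : realType.
Local Notation mR := (measurableTypeR R).

Definition expfam (u v eta zeta : R -> R) (th x : R) : R :=
  v x * expR (eta th * u x - zeta th).

Definition pE (nu : {measure set mR -> \bar R}) (p : R -> R) (g : R -> \bar R)
  : \bar R := (\int[nu]_x ((p x)%:E * g x))%E.

(* Expectation of g(X_1, ..., X_n) for X_1, ..., X_n i.i.d. with density p
   w.r.t. nu (iterated integral w.r.t. the n-fold product law). *)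
Fixpoint iidE (nu : {measure set mR -> \bar R}) (p : R -> R) (n : nat)
  (g : seq R -> \bar R) {struct n} : \bar R :=
  match n with
  | 0%N => g [::]
  | n'.+1 => pE nu p (fun x => iidE nu p n' (fun xs => g (x :: xs)))
  end.

Definition ind (b : bool) : \bar R := (b%:R)%:E.

Definition smean (u : R -> R) (xs : seq R) : R :=
  (\sum_(x <- xs) u x) / (size xs)%:R.

Definition rho (eta zeta : R -> R) (th z vt : R) : R :=
  (eta th - eta vt) * z - zeta th + zeta vt.

Definition Phi (y : R) : R :=
  fine (\int[@lebesgue_measure R]_(x in `]-oo, y]) (normal_pdf 0 1 x)%:E)%E.

Definition BerryEsseen_const (C : R) : Prop :=
  0 < C /\
  forall m : {measure set mR -> \bar R}, m setT = 1%E ->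
  let E2 := (\int[m]_y ((y ^+ 2)%:E))%E in
  let E3 := (\int[m]_y ((`|y| ^+ 3)%:E))%E in
  (E3 < +oo)%E -> (\int[m]_y (y%:E))%E = 0%E -> (0 < E2)%E ->
  forall (n : nat) (y0 : R), (0 < n)%N ->
    `| fine (iidE m (fun=> 1) n
          (fun ys => ind ((\sum_(y <- ys) y) / Num.sqrt (n%:R * fine E2) <= y0)))
       - Phi y0 |
    <= C / Num.sqrt n%:R * (fine E3 / (Num.sqrt (fine E2)) ^+ 3).

(* Delta = min{1/2, C/sqrt n * E_a|W|^3 / E_a^{3/2}|W|^2}, with W = u(X) - z
   under parameter a; the ratio is read as +oo when E_a|W|^3 = +oo or
   E_a|W|^2 = 0 (so Delta = 1/2 then). *)
Definition Delta (nu : {measure set mR -> \bar R}) (p : R -> R) (u : R -> R)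
  (z C : R) (n : nat) : R :=
  let E2 := pE nu p (fun x => (`|u x - z| ^+ 2)%:E) in
  let E3 := pE nu p (fun x => (`|u x - z| ^+ 3)%:E) in
  if ((E3 < +oo)%E && (0 < E2)%E) then
    Num.min (1/2) (C / Num.sqrt n%:R * (fine E3 / (Num.sqrt (fine E2)) ^+ 3))
  else 1/2.

End Defs.
Arguments ind {R}.

(* Main.v *)
(* Everything is reduced to the random walk S_n with steps Y = u(X) - z, whose
   step law m under alpha is centred.  Since f(., th) = f(., alpha) exp(c Y + r)
   with c = eta(th) - eta(alpha) and r = rho(z, alpha), tilting gives
   Pr_th(S_n <= 0) = e^{nr} E_alpha[e^{c S_n}; S_n <= 0].
   For c >= 0 the last expectation is at most Pr_alpha(S_n <= 0), which the
   Berry-Esseen bound at 0 controls; for c < 0 integrating 1 + t <= e^t against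
   f(., th) gives r >= -c (mu(th) - z) >= 0, and the Chernoff bound is trivial.
   For the rate it remains to bound Pr_alpha(-n eps <= S_n <= 0) from below by
   e^{-n delta}, with only a first moment at hand: the step law is truncated to
   [-M, M] and its positive part damped by a factor 1 - k, which makes the drift
   slightly negative while keeping total mass q close to 1; Chernoff bounds for
   both tails then leave a mass q^n - a^n - b^n with a, b < q in the window.
   The statements on {Z >= z} follow from the change of signs of u and eta. *)
Require Import Defs.
From HB Require Import structures.
From mathcomp Require Import all_boot all_order all_algebra.
From mathcomp Require Import all_classical all_reals all_analysis.
From mathcomp Require Import measurable_realfun ring lra.
Import Order.TTheory GRing.Theory Num.Theory.
Import numFieldNormedType.Exports.
Local Open Scope classical_set_scope.
Local Open Scope ring_scope.

(** * The image law of a density under a measurable map *)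

Section law.
Context {R : realType}.
Local Notation mR := (measurableTypeR R).
Variables (nu : {measure set mR -> \bar R}) (p Y : R -> R).
Hypotheses (mp : measurable_fun [set: mR] (p : mR -> R))
  (p0 : forall x, 0 <= p x) (p1 : pE nu p (fun=> 1%E) = 1%E)
  (mY : measurable_fun [set: mR] (Y : mR -> mR)).

(* The proof arguments make the measure instance below available to unification. *)
Definition law of measurable_fun [set: mR] (p : mR -> R) & (forall x, 0 <= p x)
    & pE nu p (fun=> 1%E) = 1%E
    & measurable_fun [set: mR] (Y : mR -> mR) : set mR -> \bar R :=
  fun A => (\int[nu]_(x in Y @^-1` A) (p x)%:E)%E.

Let law0 : law mp p0 p1 mY set0 = 0%E.
Proof. by rewrite /law preimage_set0 integral_set0. Qed.

Let law_ge0 A : (0 <= law mp p0 p1 mY A)%E.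
Proof. by apply: integral_ge0 => x _; rewrite lee_fin. Qed.

Let mpre (A : set mR) : measurable A -> measurable (Y @^-1` A : set mR).
Proof. by move=> mA; rewrite -[X in measurable X]setTI; exact: mY. Qed.

Let law_sigma_additive : semi_sigma_additive (law mp p0 p1 mY).
Proof.
move=> F mF tF mUF; rewrite /law; apply: cvg_toP.
  apply: ereal_nondecreasing_is_cvgn => i j ij.
  apply: lee_sum_nneg_natr => // k _ _.
  by apply: integral_ge0 => x _; rewrite lee_fin.
rewrite preimage_bigcup ge0_integral_bigcup//=.
- by move=> k; exact: mpre.
- exact/measurable_EFinP/measurable_funTS.
- by move=> x _; rewrite lee_fin.
- apply/trivIsetP => /= i j _ _ ij; rewrite -preimage_setI.
  by move/trivIsetP : tF => /(_ _ _ _ _ ij) ->//; rewrite preimage_set0.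
Qed.

HB.instance Definition _ := isMeasure.Build _ _ _ (law mp p0 p1 mY)
  law0 law_ge0 law_sigma_additive.

Let law_setT : law mp p0 p1 mY setT = 1%E.
Proof.
rewrite /law preimage_setT -[RHS]p1; apply: eq_integral => x _.
by rewrite mule1.
Qed.

HB.instance Definition _ := Measure_isProbability.Build _ _ R
  (law mp p0 p1 mY) law_setT.

Import HBNNSimple.

Let integral_law_indic E : measurable E ->
  (\int[law mp p0 p1 mY]_y (\1_E y)%:E = pE nu p (fun x => (\1_E (Y x))%:E))%E.
Proof.
move=> mE; rewrite integral_indic//= setIT /law /pE integral_mkcond.
apply: eq_integral => x _; rewrite patchE indicE -[x \in _]/(Y x \in E).
by case: ifPn => _; rewrite ?mule1 ?mule0.
Qed.

Let measurable_indic_comp (E : set mR) : measurable E ->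
  measurable_fun [set: mR] (fun x => \1_E (Y x) : R).
Proof.
move=> mE; have mI : measurable_fun [set: mR] (\1_E : mR -> R) by exact: measurable_indic.
exact: (measurableT_comp mI mY).
Qed.

Let integral_law_nnsfun (f : {nnsfun mR >-> R}) :
  (\int[law mp p0 p1 mY]_y (f y)%:E = pE nu p (fun x => (f (Y x))%:E))%E.
Proof.
under [LHS]eq_integral do rewrite fimfunE -fsumEFin//.
rewrite [LHS]ge0_integral_fsum//; last 2 first.
  - by move=> r; exact/measurable_EFinP/measurableT_comp.
  - by move=> n x _; rewrite EFinM nnfun_muleindic_ge0.
rewrite /pE; under [RHS]eq_integral.
  move=> x _; rewrite fimfunE -fsumEFin// ge0_mule_fsumr; last first.
    by move=> r; rewrite EFinM nnfun_muleindic_ge0.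
  over.
rewrite [RHS]ge0_integral_fsum//; last 2 first.
  - move=> r; apply: emeasurable_funM; first exact/measurable_EFinP.
    apply/measurable_EFinP; apply: measurable_funM => //.
    exact: measurable_indic_comp.
  - move=> r x _; apply: mule_ge0; first by rewrite lee_fin.
    by rewrite EFinM nnfun_muleindic_ge0.
apply: eq_fsbigr => r _.
(* A negative [r] is not a value of the simple function, so its level set is empty and both sides
   vanish; for [r] nonnegative it can be pulled out of the integrals. *)
have [r0|r0] := ltP r 0.
  rewrite !integral0_eq//.
    by move=> x _; rewrite preimage_nnfun0// indic0 mulr0 mule0.
  by move=> x _; rewrite preimage_nnfun0// indic0 mulr0.
under eq_integral do rewrite EFinM.
under [RHS]eq_integral do rewrite EFinM muleCA.
rewrite ge0_integralZl//; last exact/measurable_EFinP/measurable_indic.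
rewrite ge0_integralZl//; last 2 first.
- apply: emeasurable_funM; apply/measurable_EFinP => //.
  exact: measurable_indic_comp.
- by move=> x _; rewrite -EFinM lee_fin mulr_ge0.
by rewrite integral_law_indic.
Qed.

(** Simple functions come first; the same approximating sequence is then passed to the limit on both
    sides by monotone convergence. *)
Lemma integral_law (h : mR -> \bar R) :
  measurable_fun setT h -> (forall y, 0 <= h y)%E ->
  (\int[law mp p0 p1 mY]_y h y = pE nu p (fun x => h (Y x)))%E.
Proof.
move=> mh h0.
pose h_ := nnsfun_approx measurableT mh.
transitivity (limn (fun n => \int[law mp p0 p1 mY]_y (h_ n y)%:E))%E.
  rewrite -monotone_convergence//=.
  - apply: eq_integral => y _; apply/esym/cvg_lim => //=.
    exact: cvg_nnsfun_approx.
  - by move=> n; exact/measurable_EFinP/measurable_funTS.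
  - by move=> n y _; rewrite lee_fin.
  - by move=> y _ i j ij; rewrite lee_fin; exact/lefP/nd_nnsfun_approx.
under eq_fun do rewrite integral_law_nnsfun.
rewrite /pE -monotone_convergence//=.
- apply: eq_integral => x _; apply/cvg_lim => //=.
  by apply: cvgeZl => //; exact: cvg_nnsfun_approx.
- move=> n; apply: emeasurable_funM; apply/measurable_EFinP => //.
  exact: (measurableT_comp (measurable_funPT (h_ n)) mY).
- by move=> n x _; rewrite -EFinM lee_fin mulr_ge0.
- move=> x _ i j ij; apply: lee_wpmul2l; rewrite ?lee_fin//.
  by have /lefP := nd_nnsfun_approx measurableT mh ij; exact.
Qed.

End law.
Arguments law {R nu p Y}.
Arguments integral_law {R nu p Y}.

(** * Weighted random walks as iterated integrals *)

Section walk.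
Context {R : realType}.
Local Notation mR := (measurableTypeR R).

(* [walk m g n h s] is the integral of [h (s + y_1 + ... + y_n)] against the
   [n]-fold power of the measure with density [g] with respect to [m]. *)
Definition walk (m : {measure set mR -> \bar R}) (g : R -> R) n
    (h : R -> \bar R) : R -> \bar R :=
  iter n (fun h' s => pE m g (fun y => h' (s + y))) h.

(** A functional of the sample that depends only on the sum needs no list of past values: the
    current position suffices. The free starting point [s] is what lets the induction go through. *)
Lemma iidE_walk (m : {measure set mR -> \bar R}) g n h s :
  iidE m g n (fun ys => h (s + \sum_(y <- ys) y)) = walk m g n h s.
Proof.
elim: n s => [|n IH] s; first by rewrite /= big_nil addr0.
rewrite /=; apply: eq_integral => y _; congr (_ * _)%E.
rewrite -IH; congr iidE; apply/funext => ys.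
by rewrite big_cons addrA.
Qed.

Section theory.
Variables (m : probability mR R) (g : R -> R).
Hypotheses (mg : measurable_fun [set: mR] (g : mR -> R))
  (g0 : forall x, 0 <= g x).

Lemma walk_ge0 n h s : (forall s, 0 <= h s)%E -> (0 <= walk m g n h s)%E.
Proof.
move=> h0; elim: n s => //= n IH s.
by apply: integral_ge0 => y _; rewrite mule_ge0 ?lee_fin.
Qed.

Lemma measurable_shift (h : R -> \bar R) s :
  measurable_fun [set: mR] (h : mR -> _) ->
  measurable_fun [set: mR] (fun y : mR => h (s + y)).
Proof.
move=> mh; have ms : measurable_fun [set: mR] (fun y : mR => (s + y : mR)).
  exact: measurable_funD.
exact: (measurableT_comp mh ms).
Qed.

Lemma measurable_walk n h : measurable_fun [set: mR] (h : mR -> _) ->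
  (forall s, 0 <= h s)%E ->
  measurable_fun [set: mR] (walk m g n h : mR -> _).
Proof.
move=> mh h0; elim: n => //= n IH.
(* The integrand is taken jointly in position and step, so that Tonelli gives measurability of the
   integral in the position. *)
pose F (xy : mR * mR) := ((g xy.2)%:E * walk m g n h (xy.1 + xy.2))%E.
apply: (measurable_fun_fubini_tonelli_F (m2 := m) F).
  apply: emeasurable_funM.
    by apply/measurable_EFinP; exact: (measurableT_comp mg measurable_snd).
  have ma : measurable_fun [set: mR * mR] (fun xy : mR * mR => (xy.1 + xy.2 : mR)).
    by apply: measurable_funD; [exact: measurable_fst|exact: measurable_snd].
  exact: (measurableT_comp IH ma).
by move=> xy; rewrite /F mule_ge0 ?lee_fin//; exact: walk_ge0.
Qed.

Let measurable_integrand n h s : measurable_fun [set: mR] (h : mR -> _) ->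
  (forall s, 0 <= h s)%E ->
  measurable_fun [set: mR] (fun y : mR => (g y)%:E * walk m g n h (s + y))%E.
Proof.
move=> mh h0; apply: emeasurable_funM; first exact/measurable_EFinP.
by apply: measurable_shift; exact: measurable_walk.
Qed.

Lemma le_walk n h1 h2 s : measurable_fun [set: mR] (h1 : mR -> _) ->
  measurable_fun [set: mR] (h2 : mR -> _) -> (forall s, 0 <= h1 s)%E ->
  (forall s, h1 s <= h2 s)%E -> (walk m g n h1 s <= walk m g n h2 s)%E.
Proof.
move=> mh1 mh2 h10 h12; have h20 s' : (0 <= h2 s')%E.
  by apply: le_trans (h12 s').
elim: n s => //= n IH s; apply: ge0_le_integral => //=.
- by move=> y _; rewrite mule_ge0 ?lee_fin//; exact: walk_ge0.
- exact: measurable_integrand.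
- exact: measurable_integrand.
- by move=> y _; apply: lee_wpmul2l; rewrite ?lee_fin.
Qed.

Lemma walkD n h1 h2 s : measurable_fun [set: mR] (h1 : mR -> _) ->
  measurable_fun [set: mR] (h2 : mR -> _) -> (forall s, 0 <= h1 s)%E ->
  (forall s, 0 <= h2 s)%E ->
  (walk m g n (fun s => h1 s + h2 s) s = walk m g n h1 s + walk m g n h2 s)%E.
Proof.
move=> mh1 mh2 h10 h20; elim: n s => //= n IH s.
rewrite /pE -ge0_integralD//.
- apply: eq_integral => y _; rewrite IH muleDr//.
  by apply: ge0_adde_def; rewrite inE walk_ge0.
- by move=> y _; rewrite mule_ge0 ?lee_fin//; exact: walk_ge0.
- exact: measurable_integrand.
- by move=> y _; rewrite mule_ge0 ?lee_fin//; exact: walk_ge0.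
- exact: measurable_integrand.
Qed.

(** The exponential factors telescope: [n] steps from [s] to [S] contribute
    [expR (c * (S - s) + n%:R * r)], whose part depending on [S] is absorbed into the test
    function. *)
Lemma walk_tilt (c r : R) n h s : measurable_fun [set: mR] (h : mR -> _) ->
  (forall s, 0 <= h s)%E ->
  (walk m (fun y => g y * expR (c * y + r))%R n h s =
   (expR (n%:R * r - c * s))%:E *
     walk m g n (fun s => (expR (c * s))%:E * h s) s)%E.
Proof.
move=> mh h0.
have mch : measurable_fun [set: mR] (fun s : mR => (expR (c * s))%:E * h s)%E.
  apply: emeasurable_funM => //; apply/measurable_EFinP.
  by apply: measurableT_comp => //; exact: measurable_funM.
have ch0 t : (0 <= (expR (c * t))%:E * h t)%E.
  by rewrite mule_ge0 ?lee_fin ?expR_ge0.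
elim: n s => [|n IH] s /=.
  by rewrite muleA -EFinM -expRD mul0r sub0r addNr expR0 mul1e.
rewrite /pE -ge0_integralZl//.
- apply: eq_integral => y _; rewrite IH !muleA -!EFinM; congr (_%:E * _)%E.
  rewrite -mulrA -expRD [RHS]mulrC; congr (_ * expR _).
  by rewrite -natr1; ring.
- exact: measurable_integrand.
- by move=> y _; rewrite mule_ge0 ?lee_fin//; exact: walk_ge0.
Qed.

(** The weight [g] may have mass [q] below 1, as happens after truncation and damping; each step
    then multiplies the total mass by [q]. *)
Lemma walk_cst n q s : (\int[m]_y (g y)%:E = q%:E)%E ->
  walk m g n (fun=> 1%E) s = (q ^+ n)%:E.
Proof.
move=> gq; elim: n s => //= n IH s.
rewrite /pE; under eq_integral do rewrite IH muleC.
rewrite ge0_integralZl//.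
- by rewrite gq -EFinM exprSr.
- exact/measurable_EFinP.
- by move=> y _; rewrite lee_fin.
- have q0 : 0 <= q.
    by rewrite -lee_fin -gq; apply: integral_ge0 => y _; rewrite lee_fin.
  by rewrite lee_fin exprn_ge0.
Qed.

End theory.

Lemma le_walk_weight (m : probability mR R) g1 g2 n h s :
  measurable_fun [set: mR] (g1 : mR -> R) ->
  measurable_fun [set: mR] (g2 : mR -> R) ->
  (forall y, 0 <= g1 y) -> (forall y, g1 y <= g2 y) ->
  measurable_fun [set: mR] (h : mR -> _) -> (forall s, 0 <= h s)%E ->
  (walk m g1 n h s <= walk m g2 n h s)%E.
Proof.
move=> mg1 mg2 g10 g12 mh h0.
have g20 y : 0 <= g2 y by apply: le_trans (g12 y).
elim: n s => //= n IH s; apply: ge0_le_integral => //=.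
- by move=> y _; rewrite mule_ge0 ?lee_fin//; exact: walk_ge0.
- apply: emeasurable_funM; first exact/measurable_EFinP.
  by apply: measurable_shift; exact: measurable_walk.
- apply: emeasurable_funM; first exact/measurable_EFinP.
  by apply: measurable_shift; exact: measurable_walk.
- by move=> y _; apply: lee_pmul; rewrite ?lee_fin//; exact: walk_ge0.
Qed.

(** A factor of the density that depends on [x] only through [Y x] becomes a weight on the image
    law. Hence a single law [m] serves both parameters: weight 1 for [alpha], the likelihood ratio
    for [th]. *)
Lemma iidE_walk_law (nu : {measure set mR -> \bar R}) (p Y g : R -> R)
    (mp : measurable_fun [set: mR] (p : mR -> R)) (p0 : forall x, 0 <= p x)
    (p1 : pE nu p (fun=> 1%E) = 1%E)
    (mY : measurable_fun [set: mR] (Y : mR -> mR))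
    (mg : measurable_fun [set: mR] (g : mR -> R)) (g0 : forall x, 0 <= g x)
    n h s : measurable_fun [set: mR] (h : mR -> _) -> (forall s, 0 <= h s)%E ->
  iidE nu (fun x => p x * g (Y x)) n (fun xs => h (s + \sum_(x <- xs) Y x)) =
  walk (law mp p0 p1 mY) g n h s.
Proof.
move=> mh h0; elim: n s => [|n IH] s; first by rewrite /= big_nil addr0.
rewrite /= {2}/pE integral_law//=.
- apply: eq_integral => x _; rewrite muleA EFinM; congr (_ * _)%E.
  by rewrite -IH; congr iidE; apply/funext => xs; rewrite big_cons addrA.
- apply: emeasurable_funM; first exact/measurable_EFinP.
  by apply: measurable_shift; exact: measurable_walk.
- by move=> y; rewrite mule_ge0 ?lee_fin//; exact: walk_ge0.
Qed.

End walk.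

(** * The Berry-Esseen bound at the origin *)

Section half.
Context {R : realType}.
Local Notation mR := (measurableTypeR R).

Lemma normal_pdf01N (x : R) : normal_pdf 0 1 (- x) = normal_pdf 0 1 x.
Proof.
by rewrite /normal_pdf oner_eq0 /normal_fun !subr0 sqrrN.
Qed.

(** The substitution of [- x] for [x] matches the two half-line integrals of the even normal
    density, and together they make 1. *)
Lemma Phi0 : Phi 0 = 1 / 2 :> R.
Proof.
pose I := (\int[@lebesgue_measure R]_(x in `]-oo, 0%R]) (normal_pdf 0 1 x)%:E)%E.
have IE : I = (\int[@lebesgue_measure R]_(x in [set x | (0 <= x)%R])
    (normal_pdf 0 1 x)%:E)%E.
  rewrite /I -{1}oppr0 ge0_integration_by_substitutionNy//.
  - rewrite -set_itvcy; apply: eq_integral => x _.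
    by rewrite /= normal_pdf01N.
  - by apply: continuous_subspaceT; apply: continuous_normal_pdf; rewrite oner_eq0.
  - by move=> x _; exact: normal_pdf_ge0.
have := @integral_normal_pdf R 0 1.
rewrite ge0_symfun_integralT.
- rewrite -IE /Phi -/I.
  have : (0 <= I)%E by apply: integral_ge0 => x _; rewrite lee_fin normal_pdf_ge0.
  case: I {IE} => [i| |] //= _; last by rewrite gt0_muley.
  by move=> [] i1; lra.
- by move=> x; exact: normal_pdf_ge0.
- by apply: continuous_normal_pdf; rewrite oner_eq0.
- by move=> x; rewrite /= normal_pdf01N.
Qed.

Lemma measurable_ind (P : R -> bool) :
  measurable [set x : mR | P x] ->
  measurable_fun [set: mR] (fun x : mR => ind (P x) : \bar R).
Proof.
move=> mP; rewrite (_ : (fun _ => _) = (fun x : mR => (\1_[set x | P x] x)%:E)).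
  exact/measurable_EFinP/measurable_indic.
apply/funext => x; rewrite /ind indicE.
by have -> : (x \in [set x | P x]) = P x by apply/idP/idP; rewrite inE.
Qed.

Lemma measurable_norm_pow k :
  measurable_fun [set: mR] (fun y : mR => (`|y| ^+ k)%:E : \bar R).
Proof.
have mid : measurable_fun [set: mR] (fun y : mR => y : R) by [].
apply/measurable_EFinP; apply: measurable_funX.
exact: (measurableT_comp (@normr_measurable R setT) mid).
Qed.

Lemma ind_ge0 (b : bool) : (0 <= ind b :> \bar R)%E.
Proof. by rewrite lee_fin. Qed.

Lemma measurable_le_cst (a : R) :
  measurable_fun [set: mR] (fun x : mR => ind (x <= a) : \bar R).
Proof.
apply: measurable_ind; rewrite -[X in measurable X]set_itvNyc.
exact: measurable_itv.
Qed.

Lemma measurable_gt0 :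
  measurable_fun [set: mR] (fun x : mR => ind (0 < x) : \bar R).
Proof.
apply: measurable_ind; rewrite -[X in measurable X]set_itvoy.
exact: measurable_itv.
Qed.

Lemma measurable_norm_le (a : R) :
  measurable_fun [set: mR] (fun x : mR => ind (`|x| <= a) : \bar R).
Proof.
apply: measurable_ind.
rewrite (_ : [set _ | _] = `[- a, a]%classic); first exact: measurable_itv.
by apply/seteqP; split => x /=; rewrite in_itv/= ler_norml.
Qed.

Section berry_esseen.
Variables (m : probability mR R) (C : R).

Lemma walk_le1 n h s : measurable_fun [set: mR] (h : mR -> \bar R) ->
  (forall s, 0 <= h s <= 1)%E -> (walk m (fun=> 1%R) n h s <= 1)%E.
Proof.
move=> mh h01; rewrite -[leRHS](_ : walk m (fun=> 1%R) n (fun=> 1%E) s = 1%E).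
  by apply: le_walk => //= t; have /andP[] := h01 t.
rewrite (@walk_cst _ _ _ _ _ _ 1) ?expr1n//.
by rewrite integral_cst//= mul1e probability_setT.
Qed.

(** At the point 0 the normal value is one half. Wherever [Delta] equals one half the claim is only
    that a probability is at most 1. *)
Lemma walk_le0_half n : BerryEsseen_const C -> (\int[m]_y y%:E = 0)%E -> (0 < n)%N ->
  (walk m (fun=> 1%R) n (fun s => ind (s <= 0)%R) 0%R <=
    (1 / 2 + Delta m (fun=> 1%R) idfun 0%R C n)%:E)%E.
Proof.
move=> [C0 BE] m0 n0; rewrite /Delta.
have le1 : (walk m (fun=> 1%R) n (fun s => ind (s <= 0)%R) 0%R <= 1)%E.
  apply: walk_le1; first exact: measurable_le_cst.
  by move=> s; rewrite ind_ge0 lee_fin lern1 leq_b1.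
have half1 : 1 / 2 + 1 / 2 = 1 :> R by lra.
case: ifPn => [/andP[]|_]; last by rewrite half1.
set E3 := pE _ _ _; set E2 := pE _ _ _ => E3oo E20.
have E2E : E2 = (\int[m]_y ((y ^+ 2)%:E))%E.
  by apply: eq_integral => y _; rewrite mul1e subr0 real_normK// num_real.
have E3E : E3 = (\int[m]_y ((`|y| ^+ 3)%:E))%E.
  by apply: eq_integral => y _; rewrite mul1e subr0.
(* The second moment is finite because [y ^+ 2 <= 1 + |y| ^+ 3]. Without this [fine E2] could be the
   default value 0 and the normalisation would degenerate. *)
have E2oo : (E2 < +oo)%E.
  apply: (@le_lt_trans _ _ (1 + E3)%E); last by rewrite lte_add_pinfty// ltry.
  have -> : (1 + E3)%E = (\int[m]_y (1 + (`|y| ^+ 3)%:E))%E.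
    rewrite ge0_integralD//.
    - by rewrite integral_cst//= mul1e probability_setT E3E.
    - exact: measurable_norm_pow.
  rewrite E2E; apply: ge0_le_integral => //=.
  - by move=> y _; rewrite lee_fin sqr_ge0.
  - by apply/measurable_EFinP; apply: measurable_funX.
  - by apply: emeasurable_funD => //; exact: measurable_norm_pow.
  - move=> y _; rewrite lee_fin -[y ^+ 2]real_normK ?num_real//.
    have := normr_ge0 y; set a := `|y| => a0.
    have [a1|a1] := leP a 1.
      have : a ^+ 2 <= 1 by rewrite exprn_ile1.
      have : 0 <= a ^+ 3 by rewrite exprn_ge0.
      by lra.
    have : a ^+ 2 * 1 <= a ^+ 2 * a by rewrite ler_wpM2l ?exprn_ge0// ltW.
    by rewrite -exprSr; lra.
have s0 : 0 < Num.sqrt (n%:R * fine E2).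
  by rewrite sqrtr_gt0 mulr_gt0 ?ltr0n// fine_gt0// E20.
have {BE} := BE m (@probability_setT _ _ _ m); rewrite -E2E -E3E.
move=> /(_ E3oo m0 E20 n 0 n0); rewrite Phi0.
set F := iidE _ _ _ _.
(* Dividing by the positive scale does not change the sign of the sum, so the normalisation
   disappears from the event. *)
have -> : F = walk m (fun=> 1%R) n (fun s => ind (s <= 0)%R) 0%R.
  rewrite -iidE_walk; congr iidE; apply/funext => ys; rewrite add0r.
  by rewrite pmulr_lle0// invr_gt0.
move=> BE; move: le1 BE.
have := @walk_ge0 _ m (fun=> 1) (fun=> ler01) n (fun s => ind (s <= 0)) 0 (fun s => ind_ge0 _).
case: walk => [w| |] // _; rewrite !lee_fin /= => w1 /ler_normlP[_ wB].
by rewrite addrC -lerBlDr le_min; apply/andP; split; lra.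
Qed.

End berry_esseen.

(** Only absolute moments of [u - z] enter [Delta], and these pass to the image law by change of
    variables. *)
Lemma Delta_law (nu : {measure set mR -> \bar R}) (p u : R -> R) (z C : R)
    (mp : measurable_fun [set: mR] (p : mR -> R)) (p0 : forall x, 0 <= p x)
    (p1 : pE nu p (fun=> 1%E) = 1%E)
    (mY : measurable_fun [set: mR] ((fun x => u x - z) : mR -> mR)) n :
  Delta nu p u z C n = Delta (law mp p0 p1 mY) (fun=> 1) idfun 0 C n.
Proof.
have E k : pE (law mp p0 p1 mY) (fun=> 1) (fun y => (`|idfun y - 0| ^+ k)%:E) =
    pE nu p (fun x => (`|u x - z| ^+ k)%:E).
  rewrite {1}/pE integral_law//=.
  - by apply: eq_integral => x _; rewrite mul1e subr0.
  - apply: emeasurable_funM => //; under eq_fun do rewrite subr0.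
    exact: measurable_norm_pow.
by rewrite /Delta !E.
Qed.

End half.

(** * Chernoff bounds for weighted steps *)

Section lower_bound.
Context {R : realType}.
Local Notation mR := (measurableTypeR R).

(** From [1 - x <= expR (- x)] one gets [expR x <= 1 / (1 - x)], and
    [(1 + x + 2 * x ^+ 2) * (1 - x)] exceeds 1 by [x ^+ 2 * (1 - 2 * x)]. *)
Lemma expR_le_quadratic (x : R) : x <= 1 / 2 -> expR x <= 1 + x + 2 * x ^+ 2.
Proof.
move=> x2; have x1 : 0 < 1 - x by lra.
have : expR x * (1 - x) <= 1.
  rewrite -[leRHS](_ : expR x * expR (- x) = 1); last by rewrite -expRD subrr expR0.
  by rewrite ler_pM2l ?expR_gt0// expR_ge1Dx.
rewrite -ler_pdivlMr// => /le_trans; apply.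
rewrite ler_pdivrMr//.
have : 0 <= x ^+ 2 * (1 - 2 * x) by rewrite mulr_ge0 ?sqr_ge0//; lra.
by nra.
Qed.

Section weights.
Variable m : probability mR R.

Lemma integrable_bounded (f : R -> R) (K : R) :
  measurable_fun [set: mR] (f : mR -> R) -> (forall y, `|f y| <= K) ->
  m.-integrable setT (EFin \o f).
Proof.
move=> mf fK; apply: (measurable_bounded_integrable _ _ mf) => //.
  by rewrite [X in (X < _)%E]probability_setT ltry.
exists K; split; first exact: num_real.
by move=> M KM y _; apply: le_trans (fK y) (ltW KM).
Qed.

Lemma integrable_EFin_cst (k : R) : m.-integrable setT (EFin \o (fun=> k)).
Proof. exact: (@integrable_bounded _ `|k|). Qed.

Lemma integrable_EFinD (f1 f2 : R -> R) : m.-integrable setT (EFin \o f1) ->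
  m.-integrable setT (EFin \o f2) ->
  m.-integrable setT (EFin \o (fun y => f1 y + f2 y)).
Proof. by move=> if1 if2; exact: (integrableD measurableT if1 if2). Qed.

Lemma integrable_EFinZ (k : R) (f : R -> R) : m.-integrable setT (EFin \o f) ->
  m.-integrable setT (EFin \o (fun y => k * f y)).
Proof. by move=> intf; exact: (integrableZl measurableT k intf). Qed.

Lemma EFin_Rintegral (f : R -> R) : m.-integrable setT (EFin \o f) ->
  (\int[m]_y f y)%:E = (\int[m]_y (f y)%:E)%E.
Proof. by move=> intf; rewrite fineK// integrable_fin_num. Qed.

Section chernoff.
Variable g : R -> R.
Hypotheses (mg : measurable_fun [set: mR] (g : mR -> R))
  (g01 : forall y, 0 <= g y <= 1).

Let g0 y : 0 <= g y. Proof. by have /andP[] := g01 y. Qed.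
Let g1 y : g y <= 1. Proof. by have /andP[] := g01 y. Qed.

Lemma integrable_weight : m.-integrable setT (EFin \o g).
Proof. by apply: (@integrable_bounded _ 1) => // y; rewrite ger0_norm. Qed.

(* A negative drift makes the moment generating function drop below its value
   at [0]. *)
Lemma tilt_lt (L : R -> R) (K : R) :
  measurable_fun [set: mR] (L : mR -> R) -> 0 < K ->
  (forall y, g y != 0 -> `|L y| <= K) -> \int[m]_y (g y * L y) < 0 ->
  exists2 t, 0 < t & m.-integrable setT (EFin \o (fun y => g y * expR (t * L y))) /\
    \int[m]_y (g y * expR (t * L y)) < \int[m]_y g y.
Proof.
move=> mL K0 LK; set B := Rintegral _ _ _ => B0.
(* The first bound keeps [t * L y] below one half, where the quadratic estimate applies. The second
   keeps the remainder [2 * t ^+ 2 * K ^+ 2] within half of the gain [- t * B]. *)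
pose t := Num.min ((2 * K)^-1) (- B / (4 * K ^+ 2)).
have K2 : 0 < K ^+ 2 by rewrite exprn_gt0.
have t0 : 0 < t.
  by rewrite lt_min invr_gt0 mulr_gt0//= divr_gt0 ?oppr_gt0// mulr_gt0.
have tK : t * K <= 1 / 2.
  have tK' : t <= (2 * K)^-1 by rewrite ge_min lexx.
  have -> : 1 / 2 = (2 * K)^-1 * K by field; rewrite gt_eqF.
  by rewrite ler_pM2r.
have tB : 4 * t * K ^+ 2 <= - B.
  have : t <= - B / (4 * K ^+ 2) by rewrite ge_min lexx orbT.
  by rewrite ler_pdivlMr ?mulr_gt0//; lra.
have tL y : g y != 0 -> t * L y <= 1 / 2 /\ (t * L y) ^+ 2 <= t ^+ 2 * K ^+ 2.
  move=> /LK Ly; split.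
    apply: le_trans tK; rewrite ler_pM2l//.
    by apply: le_trans Ly; exact: ler_norm.
  rewrite exprMn ler_pM2l ?exprn_gt0// -[L y ^+ 2]real_normK ?num_real//.
  by rewrite ler_pXn2r// ?nnegrE ?normr_ge0// ltW.
have mgL : measurable_fun [set: mR] (fun y : mR => g y * L y).
  exact: measurable_funM.
have igL : m.-integrable setT (EFin \o (fun y => g y * L y)).
  apply: (@integrable_bounded _ K) => // y; rewrite normrM ger0_norm//.
  have [->|gy] := eqVneq (g y) 0; first by rewrite mul0r ltW.
  by rewrite -[leRHS]mul1r ler_pM// LK.
have mgE : measurable_fun [set: mR] (fun y : mR => g y * expR (t * L y)).
  apply: measurable_funM => //; apply: measurableT_comp => //.
  exact: measurable_funM.
have gE y : g y * expR (t * L y) <= (g y + t * (g y * L y)) + 2 * t ^+ 2 * K ^+ 2.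
  have [->|gy] := eqVneq (g y) 0.
    by rewrite !mul0r mulr0 !add0r mulr_ge0 ?mulr_ge0 ?exprn_ge0// ltW.
  have [/expR_le_quadratic e1 e2] := tL _ gy.
  have h1 : g y * expR (t * L y) <= g y * (1 + t * L y + 2 * (t * L y) ^+ 2).
    by rewrite ler_wpM2l.
  have h2 : g y * (2 * (t * L y) ^+ 2) <= 1 * (2 * (t ^+ 2 * K ^+ 2)).
    by apply: ler_pM => //; [rewrite mulr_ge0// sqr_ge0|rewrite ler_pM2l].
  by lra.
have igE : m.-integrable setT (EFin \o (fun y => g y * expR (t * L y))).
  apply: (@integrable_bounded _ (expR (1 / 2))) => // y.
  rewrite ger0_norm ?mulr_ge0 ?expR_ge0//.
  have [->|gy] := eqVneq (g y) 0; first by rewrite mul0r expR_ge0.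
  rewrite -[leRHS]mul1r ler_pM ?expR_ge0// ler_expR.
  by have [] := tL _ gy.
exists t => //; split => //.
have itgL := integrable_EFinZ t _ igL.
have i1 := integrable_EFinD _ _ integrable_weight itgL.
have i2 := integrable_EFin_cst (2 * t ^+ 2 * K ^+ 2).
apply: (@le_lt_trans _ _ (\int[m]_y ((g y + t * (g y * L y)) + 2 * t ^+ 2 * K ^+ 2))).
  by apply: le_Rintegral => //; exact: integrable_EFinD.
have ig := integrable_weight.
rewrite RintegralD// RintegralD// RintegralZl// -/B.
rewrite Rintegral_cst// [X in fine X]probability_setT mulr1.
have : t * (4 * t * K ^+ 2) <= t * - B by rewrite ler_pM2l.
have : 0 < t * - B by rewrite mulr_gt0// oppr_gt0.
by rewrite expr2; lra.
Qed.

Lemma walkZl n k h s : measurable_fun [set: mR] (h : mR -> \bar R) ->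
  (forall s, 0 <= h s)%E -> 0 <= k ->
  (walk m g n (fun s => k%:E * h s) s = k%:E * walk m g n h s)%E.
Proof.
move=> mh h0 k0; elim: n s => //= n IH s; rewrite /pE -ge0_integralZl//.
- by apply: eq_integral => y _; rewrite IH muleCA.
- apply: emeasurable_funM; first exact/measurable_EFinP.
  by apply: measurable_shift; exact: measurable_walk.
- by move=> y _; rewrite mule_ge0 ?lee_fin//; exact: walk_ge0.
Qed.

Lemma measurable_affine_gt0 (c r : R) :
  measurable_fun [set: mR] (fun s : mR => ind (0 < c * s + r) : \bar R).
Proof.
have mL : measurable_fun [set: mR] (fun s : mR => c * s + r).
  by apply: measurable_funD => //; exact: measurable_funM.
apply: measurable_ind.
rewrite (_ : [set _ | _] = setT `&` (fun s : mR => c * s + r) @^-1` `]0, +oo[%classic).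
  exact: mL.
by apply/seteqP; split => s /=; rewrite in_itv/= andbT => //; case.
Qed.

(** On the event the factor [expR (c * s + n%:R * r)] is at least 1; its integral is the total mass
    of the walk with tilted weight, hence an [n]-th power. *)
Lemma walk_chernoff (c r : R) n :
  m.-integrable setT (EFin \o (fun y => g y * expR (c * y + r))) ->
  (walk m g n (fun s => ind (0 < c * s + n%:R * r)%R) 0%R <=
    ((\int[m]_y (g y * expR (c * y + r)))%R ^+ n)%:E)%E.
Proof.
move=> ig.
have mL : measurable_fun [set: mR] (fun s : mR => expR (c * s)).
  by apply: measurableT_comp => //; exact: measurable_funM.
rewrite -(@walk_cst _ m _ _ _ n _ 0 (esym (EFin_Rintegral _ ig))); last 2 first.
- apply: measurable_funM => //; apply: measurableT_comp => //.
  by apply: measurable_funD => //; exact: measurable_funM.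
- by move=> y; rewrite mulr_ge0 ?expR_ge0.
rewrite walk_tilt// mulr0 subr0 -walkZl ?expR_ge0//; last first.
  by apply: emeasurable_funM => //; exact/measurable_EFinP.
apply: le_walk => //.
- exact: measurable_affine_gt0.
- do 2 apply: emeasurable_funM => //; exact/measurable_EFinP.
- by move=> s; exact: ind_ge0.
- move=> s; rewrite mule1 -EFinM -expRD lee_fin.
  have [s0|s0] := ltP 0 (c * s + n%:R * r); last by rewrite expR_ge0.
  by rewrite mulr1n -[leLHS]expR0 ler_expR addrC ltW.
Qed.

End chernoff.
End weights.
End lower_bound.

(** * Mass of a weighted walk in a window below the origin *)

Section window.
Context {R : realType}.
Local Notation mR := (measurableTypeR R).

(** With a quarter as the fraction, two such terms can be taken from [q ^+ n] and what is left still
    dominates a third. *)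
Lemma near_exprn_le_quarter (a q : R) : 0 <= a -> a < q ->
  \forall n \near \oo, a ^+ n <= q ^+ n / 4.
Proof.
move=> a0 aq; have q0 : 0 < q by apply: le_lt_trans aq.
have aq1 : `|a / q| < 1.
  by rewrite ger0_norm ?divr_ge0 ?(ltW q0)// ltr_pdivrMr// mul1r.
have /cvgrPdist_le/(_ (1 / 4)) := cvg_expr aq1.
move=> /(_ ltac:(lra)); apply: filterS => n.
rewrite sub0r normrN expr_div_n ger0_norm; last first.
  by rewrite divr_ge0 ?exprn_ge0// ltW.
by rewrite ler_pdivrMr ?exprn_gt0//; lra.
Qed.

Section law.
Variable m : probability mR R.

(** The window lies inside the event [s <= 0], and on it a tilt [expR (c * s)] costs at most the
    factor [expR (- (n%:R * (|c| * eps)))]. *)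
Definition window (eps : R) n (s : R) : \bar R :=
  ind ((- (n%:R * eps) <= s) && (s <= 0)).

Lemma measurable_window eps n : measurable_fun [set: mR] (window eps n : mR -> _).
Proof.
apply: measurable_ind.
rewrite (_ : [set _ | _] = `[- (n%:R * eps), 0]%classic); first exact: measurable_itv.
by apply/seteqP; split => s /=; rewrite in_itv.
Qed.

(** The two sign conditions put the normalised mean step strictly between [- eps] and 0, so leaving
    the window on either side is exponentially rare relative to the total mass. *)
Lemma near_walk_window_weight (g : R -> R) (M eps delta : R) :
  measurable_fun [set: mR] (g : mR -> R) -> (forall y, 0 <= g y <= 1) ->
  0 < M -> 0 < eps -> (forall y, g y != 0 -> `|y| <= M) ->
  \int[m]_y (g y * y) < 0 -> \int[m]_y (g y * - (y + eps)) < 0 ->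
  expR (- delta) < \int[m]_y g y ->
  \forall n \near \oo,
    ((expR (- (n%:R * delta)))%:E <= walk m g n (window eps n) 0)%E.
Proof.
move=> mg g01 M0 eps0 gM.
have g0 y : 0 <= g y by have /andP[] := g01 y.
have mid : measurable_fun [set: mR] (fun y : mR => y : R) by [].
have meps : measurable_fun [set: mR] (fun y : mR => - (y + eps) : R).
  by apply: measurable_funN; exact: measurable_funD.
move=> /(tilt_lt m g mg g01 (fun y => y) M mid M0 gM) [t1 t10 [i1 lt1]].
have gMe y : g y != 0 -> `|- (y + eps)| <= M + eps.
  by move=> /gM yM; rewrite normrN (le_trans (ler_normD _ _))// (gtr0_norm eps0) lerD2r.
move=> /(tilt_lt m g mg g01 _ (M + eps) meps (addr_gt0 M0 eps0) gMe) [t2 t20 [i2 lt2]].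
move=> dq; set q := (\int[m]_y g y) in lt1 lt2 dq *.
have {i1 lt1} [i1 lt1] : m.-integrable setT (EFin \o (fun y => g y * expR (t1 * y + 0))) /\
    \int[m]_y (g y * expR (t1 * y + 0)) < q.
  have E : (fun y => g y * expR (t1 * y + 0)) = (fun y => g y * expR (t1 * y)).
    by apply/funext => y; rewrite addr0.
  by rewrite E.
(* In this form the Chernoff event is [- t2 * s - n%:R * (t2 * eps) > 0], that is, exit below
   [- (n%:R * eps)]. *)
have {i2 lt2} [i2 lt2] :
    m.-integrable setT (EFin \o (fun y => g y * expR (- t2 * y + - (t2 * eps)))) /\
    \int[m]_y (g y * expR (- t2 * y + - (t2 * eps))) < q.
  have E : (fun y => g y * expR (- t2 * y + - (t2 * eps))) =
      (fun y => g y * expR (t2 * - (y + eps))).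
    by apply/funext => y; congr (_ * expR _); ring.
  by rewrite E.
set a := Rintegral _ _ _ in lt1; set b := Rintegral _ _ _ in lt2.
have a0 : 0 <= a by apply: Rintegral_ge0 => y _; rewrite mulr_ge0 ?expR_ge0.
have b0 : 0 <= b by apply: Rintegral_ge0 => y _; rewrite mulr_ge0 ?expR_ge0.
near=> n.
have an : a ^+ n <= q ^+ n / 4 by near: n; exact: near_exprn_le_quarter.
have bn : b ^+ n <= q ^+ n / 4 by near: n; exact: near_exprn_le_quarter.
have dn : expR (- delta) ^+ n <= q ^+ n / 4.
  by near: n; apply: near_exprn_le_quarter => //; exact: expR_ge0.
have d0 : 0 <= expR (- delta) ^+ n by rewrite exprn_ge0 ?expR_ge0.
have ch1 := walk_chernoff m g mg g01 t1 0 n i1.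
have ch2 := walk_chernoff m g mg g01 (- t2) (- (t2 * eps)) n i2.
rewrite -/a in ch1; rewrite -/b in ch2.
have qn : (q ^+ n)%:E = walk m g n (fun=> 1%E) 0.
  by rewrite (walk_cst m g mg g0 n q 0)// EFin_Rintegral//; exact: integrable_weight.
(* Every end point lies in the window, above it or below it, so the three indicators add up to at
   least 1. *)
have : ((q ^+ n)%:E <= walk m g n (window eps n) 0 +
   (walk m g n (fun s => ind (0 < t1 * s + n%:R * 0)%R) 0 +
    walk m g n (fun s => ind (0 < - t2 * s + n%:R * - (t2 * eps))%R) 0))%E.
  have mw := measurable_window eps n.
  have m1 := measurable_affine_gt0 t1 (n%:R * 0).
  have m2 := measurable_affine_gt0 (- t2) (n%:R * - (t2 * eps)).
  rewrite qn -walkD//; do ?[by move=> s; exact: ind_ge0].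
  rewrite -walkD//; last 3 first.
  - exact: emeasurable_funD.
  - by move=> s; exact: ind_ge0.
  - by move=> s; rewrite adde_ge0 ?ind_ge0.
  apply: le_walk => //; first by do 2 apply: emeasurable_funD => //.
  move=> s; rewrite /window /ind mulr0 addr0 pmulr_rgt0//.
  rewrite -!EFinD lee_fin.
  have -> : (0 < - t2 * s + n%:R * - (t2 * eps)) = (s < - (n%:R * eps)).
    rewrite (_ : - t2 * s + _ = t2 * (- (n%:R * eps) - s)); last by ring.
    by rewrite pmulr_rgt0// subr_gt0.
  by case: ltP => _; case: leP => _ /=; lra.
(* The window keeps at least [q ^+ n - a ^+ n - b ^+ n], which is at least half of [q ^+ n] and thus
   above [expR (- delta) ^+ n]. *)
move=> /le_trans => /(_ _ (leeD2l _ (leeD ch1 ch2))).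
rewrite -[- (n%:R * delta)]mulrN expRM_natl.
move: (walk_ge0 m g g0 n (window eps n) 0 (fun s => ind_ge0 _)).
case: walk => [w| |] //=; last by move=> _ _; rewrite leey.
by move=> _; rewrite -!EFinD !lee_fin; lra.
Unshelve. all: by end_near.
Qed.

(** At each [y] the integrand is eventually constant in [n], and [|f|] dominates. *)
Lemma truncation_cvg (f : R -> R) : m.-integrable setT (EFin \o f) ->
  \int[m]_y (f y * (`|y| <= n%:R)%R%:R) @[n --> \oo] --> \int[m]_y f y.
Proof.
move=> intf; have mf := measurable_int _ intf.
have mfn n : measurable_fun [set: mR] (fun y : mR => (f y * (`|y| <= n%:R)%R%:R)%:E).
  under eq_fun do rewrite EFinM.
  by apply: emeasurable_funM => //; exact: measurable_norm_le.
have ff y : (f y * (`|y| <= n%:R)%R%:R)%:E @[n --> \oo] --> (f y)%:E.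
  apply: cvg_near_cst; near=> n.
  rewrite (_ : `|y| <= n%:R) ?mulr1//; near: n; exact: nbhs_infty_ger.
have aeff : {ae m, forall y, setT y ->
    (f y * (`|y| <= n%:R)%R%:R)%:E @[n --> \oo] --> (EFin \o f) y}.
  by apply: aeW => y _; exact: ff.
have aefg : {ae m, forall y n, setT y ->
    (`|(f y * (`|y| <= n%:R)%R%:R)%:E| <= (abse \o (EFin \o f)) y)%E}.
  apply: aeW => y n _; rewrite /= lee_fin normrM ler_piMr//.
  by rewrite ger0_norm// lern1 leq_b1.
have [_ _] := dominated_convergence measurableT mfn mf aeff (integrable_abse intf) aefg.
by move=> cv; apply: fine_cvg; rewrite EFin_Rintegral.
Unshelve. all: by end_near.
Qed.

End law.
End window.

(** * Window probabilities of a centred walk with a first moment *)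

Section mean_zero.
Context {R : realType}.
Local Notation mR := (measurableTypeR R).
Variable m : probability mR R.
Hypotheses (intm : m.-integrable setT (EFin \o (idfun : R -> R)))
  (mean0 : (\int[m]_y y%:E = 0)%E)
  (pos : (0 < \int[m]_y ind (0 < y)%R)%E).

Let pos_ind (y : R) : R := (0 < y)%R%:R.

Let mpos_ind : measurable_fun [set: mR] (pos_ind : mR -> R).
Proof. by apply/measurable_EFinP; exact: measurable_gt0. Qed.

Let int_pos : m.-integrable setT (EFin \o (fun y => y * pos_ind y)).
Proof.
apply: le_integrable intm => //.
- by apply/measurable_EFinP; exact: measurable_funM.
- move=> y _ /=; rewrite lee_fin normrM ler_piMr//.
  by rewrite ger0_norm// lern1 leq_b1.
Qed.

(** A nonnegative function with zero integral vanishes almost everywhere, which would make the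
    half-line of positive steps null. Strict positivity is what makes damping the positive part
    lower the drift. *)
Lemma Rintegral_pos_part_gt0 : 0 < \int[m]_y (y * (0 < y)%R%:R).
Proof.
have pp0 (y : R) : 0 <= y * pos_ind y.
  by rewrite /pos_ind; case: ltP => [/ltW y0|_]; rewrite ?mulr1 ?mulr0.
rewrite lt_neqAle Rintegral_ge0 ?andbT//; apply/eqP => k0.
have /ae_eq_integral_abs : (\int[m]_y `|(y * pos_ind y)%:E| = 0)%E.
  transitivity (\int[m]_y (y * pos_ind y)%:E)%E.
    by apply: eq_integral => y _; rewrite gee0_abs// lee_fin.
  by rewrite -EFin_Rintegral// -k0.
move=> /(_ measurableT (measurable_int _ int_pos)) ae0.
have : (\int[m]_y (ind (0 < y)%R) = \int[m]_y cst 0 y)%E.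
  apply: ae_eq_integral => //; first exact: measurable_gt0.
  apply: filterS ae0 => y /[apply] /= -[] /eqP.
  rewrite /ind /pos_ind; case: ltP => // y0 /[!mulr1] /eqP yE.
  by rewrite yE ltxx in y0.
by rewrite integral0 => i0; move: pos; rewrite i0 ltxx.
Qed.

Lemma near_walk_window (eps delta : R) : 0 < eps -> 0 < delta ->
  \forall n \near \oo, ((expR (- (n%:R * delta)))%:E <=
    walk m (fun=> 1%R) n (window eps n) 0%R)%E.
Proof.
move=> eps0 delta0; have := Rintegral_pos_part_gt0.
set kappa := Rintegral _ _ _ => kappa0.
have ed : expR (- delta) < 1 by rewrite expR_lt1 oppr_lt0.
(* In order: the weight keeps mass at least one half; this mass, at least [1 - k], exceeds
   [expR (- delta)]; the drift [- (k * kappa)] is no lower than [- eps / 4], hence above [- eps]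
   times the mass. *)
pose k := Num.min (1 / 2) (Num.min ((1 - expR (- delta)) / 2) (eps / (4 * kappa))).
have k0 : 0 < k.
  by rewrite !lt_min !divr_gt0 ?mulr_gt0//; lra.
have k2 : k <= 1 / 2 by rewrite ge_min lexx.
have kd : k <= (1 - expR (- delta)) / 2 by rewrite !ge_min lexx orbT.
have kk : k * kappa <= eps / 4.
  have : k <= eps / (4 * kappa) by rewrite !ge_min lexx !orbT.
  by rewrite ler_pdivlMr ?mulr_gt0//; lra.
have pi01 y : 0 <= pos_ind y <= 1 by rewrite /pos_ind ler0n lern1 leq_b1.
pose w y := 1 - k * pos_ind y.
have mw : measurable_fun [set: mR] (w : mR -> R).
  by apply: measurable_funB => //; exact: measurable_funM.
have w01 y : 1 - k <= w y <= 1.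
  have /andP[p0 p1] := pi01 y.
  have : 0 <= k * pos_ind y by rewrite mulr_ge0// ltW.
  have : k * pos_ind y <= k * 1 by rewrite ler_pM2l.
  by rewrite /w; lra.
have w0 y : 0 <= w y by have /andP[h _] := w01 y; lra.
have iw : m.-integrable setT (EFin \o w).
  apply: (@integrable_bounded _ m w 1) => // y.
  by rewrite ger0_norm//; have /andP[] := w01 y.
have W : 1 - k <= \int[m]_y w y.
  rewrite -[leLHS](_ : \int[m]_y (1 - k) = 1 - k); last first.
    by rewrite Rintegral_cst// [X in fine X]probability_setT mulr1.
  apply: le_Rintegral => //; first exact: integrable_EFin_cst.
  by move=> y _; have /andP[] := w01 y.
have iwyE : (fun y => y + - k * (y * pos_ind y)) = (fun y => w y * y).
  by apply/funext => y; rewrite /w; ring.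
have ikp := integrable_EFinZ m (- k) _ int_pos.
have iwy : m.-integrable setT (EFin \o (fun y => w y * y)).
  by rewrite -iwyE; exact: (integrable_EFinD m _ _ intm).
(* Since the mean is zero, only the damping of the positive part contributes. *)
have Wy : \int[m]_y (w y * y) = - (k * kappa).
  rewrite -[LHS](_ : \int[m]_y (y + - k * (y * pos_ind y)) = _); last first.
    by rewrite iwyE.
  rewrite RintegralD// RintegralZl// -/kappa.
  by rewrite [X in X + _](_ : _ = 0) ?add0r ?mulNr// /Rintegral mean0.
have iweE : (fun y => - 1 * (w y * y) + - eps * w y) = (fun y => w y * - (y + eps)).
  by apply/funext => y; ring.
have i1 := integrable_EFinZ m (- 1) _ iwy.
have i2 := integrable_EFinZ m (- eps) _ iw.
have iwe : m.-integrable setT (EFin \o (fun y => w y * - (y + eps))).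
  by rewrite -iweE; exact: (integrable_EFinD m _ _ i1 i2).
have We : \int[m]_y (w y * - (y + eps)) < 0.
  rewrite -[ltLHS](_ : \int[m]_y (- 1 * (w y * y) + - eps * w y) = _); last first.
    by rewrite iweE.
  rewrite RintegralD// !RintegralZl// Wy.
  have : eps * (1 - k) <= eps * \int[m]_y w y by rewrite ler_pM2l.
  have : eps * (1 / 2) <= eps * (1 - k) by rewrite ler_pM2l//; lra.
  by lra.
(* All three conditions are strict, so they survive truncation at a large level [N]. *)
have [N] : exists N : nat, [/\ (0 < N)%N,
    expR (- delta) < \int[m]_y (w y * (`|y| <= N%:R)%R%:R),
    \int[m]_y (w y * y * (`|y| <= N%:R)%R%:R) < 0 &
    \int[m]_y (w y * - (y + eps) * (`|y| <= N%:R)%R%:R) < 0].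
  near \oo => N; exists N; split.
  - by near: N; exact: nbhs_infty_gt.
  - near: N; apply: cvgr_gt (truncation_cvg m _ iw) _ _; lra.
  - near: N; apply: cvgr_lt (truncation_cvg m _ iwy) _ _.
    by rewrite Wy oppr_lt0 mulr_gt0.
  - by near: N; apply: cvgr_lt (truncation_cvg m _ iwe) _ _.
move=> [N0 N1 N2 N3].
pose g y := w y * (`|y| <= N%:R)%R%:R.
have mg : measurable_fun [set: mR] (g : mR -> R).
  apply: measurable_funM => //; apply/measurable_EFinP.
  exact: measurable_norm_le.
have g01 y : 0 <= g y <= 1.
  rewrite mulr_ge0//= mulr_ile1// ?lern1 ?leq_b1//.
  by have /andP[] := w01 y.
have gN y : g y != 0 -> `|y| <= N%:R.
  by rewrite /g; case: leP => //; rewrite mulr0 eqxx.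
have G2 : \int[m]_y (g y * y) < 0.
  rewrite -[ltLHS](_ : \int[m]_y (w y * y * (`|y| <= N%:R)%R%:R) = _)//.
  by apply: eq_Rintegral => y _; rewrite /g mulrAC.
have G3 : \int[m]_y (g y * - (y + eps)) < 0.
  rewrite -[ltLHS](_ : \int[m]_y (w y * - (y + eps) * (`|y| <= N%:R)%R%:R) = _)//.
  by apply: eq_Rintegral => y _; rewrite /g mulrAC.
have N0' : 0 < N%:R :> R by rewrite ltr0n.
have := near_walk_window_weight m g N%:R eps delta mg g01 N0' eps0 gN G2 G3 N1.
(* The truncated and damped weight is at most 1, so restoring the full step law can only increase
   the mass of the window. *)
apply: filterS => n /le_trans; apply; apply: le_walk_weight => //.
- by move=> y; have /andP[] := g01 y.
- by move=> y; have /andP[] := g01 y.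
- exact: measurable_window.
- by move=> s; exact: ind_ge0.
Unshelve. all: by end_near.
Qed.

End mean_zero.

(** * Integrals under the density and under the image law *)

Section transfer.
Context {R : realType}.
Local Notation mR := (measurableTypeR R).
Variable nu : {measure set mR -> \bar R}.

(** Only samples of length [n] are ever evaluated. This allows the denominator of [smean] to be
    treated as the fixed number [n]. *)
Lemma eq_iidE (p : R -> R) n (g1 g2 : seq R -> \bar R) :
  (forall xs, size xs = n -> g1 xs = g2 xs) -> iidE nu p n g1 = iidE nu p n g2.
Proof.
elim: n g1 g2 => [|n IH] g1 g2 g12 /=; first exact: g12.
apply: eq_integral => x _; congr (_ * _)%E; apply: IH => xs xsn.
by apply: g12; rewrite /= xsn.
Qed.

Variables (p Y : R -> R).
Hypotheses (mp : measurable_fun [set: mR] (p : mR -> R))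
  (p0 : forall x, 0 <= p x) (p1 : pE nu p (fun=> 1%E) = 1%E)
  (mY : measurable_fun [set: mR] (Y : mR -> mR)).
Local Notation m := (law mp p0 p1 mY).

Section integrable.
Variable h : R -> R.
Hypotheses (mh : measurable_fun [set: mR] (h : mR -> R))
  (ih : nu.-integrable setT (fun x => (p x * h (Y x))%:E)).

Lemma integrable_law : m.-integrable setT (EFin \o h).
Proof.
apply/integrableP; split; first exact/measurable_EFinP.
rewrite integral_law//=; last first.
  have mE : measurable_fun [set: mR] (fun y : mR => (h y)%:E).
    exact/measurable_EFinP.
  exact: (measurableT_comp (@abse_measurable R setT) mE).
have /integrableP[_] := ih; apply: le_lt_trans.
rewrite le_eqVlt; apply/orP; left; apply/eqP; apply: eq_integral => x _.
by rewrite /= normrM (ger0_norm (p0 x)) EFinM.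
Qed.

(** The nonnegative change of variables is applied to the positive and negative parts of [h], with
    which multiplication by [p x >= 0] commutes. *)
Lemma integral_law_EFin : (\int[m]_y (h y)%:E = \int[nu]_x (p x * h (Y x))%:E)%E.
Proof.
rewrite integralE [RHS]integralE.
have mE : measurable_fun [set: mR] (fun y : mR => (h y)%:E).
  exact/measurable_EFinP.
rewrite !integral_law//=.
- congr (_ - _)%E; apply: eq_integral => x _.
  + by rewrite !funeposE -!EFin_max -EFinM maxr_pMr// mulr0.
  + by rewrite !funenegE -!EFinN -!EFin_max -EFinM maxr_pMr// mulr0 mulrN.
- exact: measurable_funeneg.
- exact: measurable_funepos.
Qed.

End integrable.
End transfer.

(** * The lower tail of the sample mean *)

Section one_sided.
Context {R : realType}.
Local Notation mR := (measurableTypeR R).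
Variables (nu : {measure set mR -> \bar R}) (u v eta zeta : R -> R) (C : R).
Hypotheses (Hu : measurable_fun setT u) (Hv : measurable_fun setT v)
  (Hv0 : forall x, 0 <= v x) (HC : BerryEsseen_const C).
Local Notation f := (expfam u v eta zeta).
Variables (th alpha mth z : R).
Hypotheses (dens_th : pE nu (f th) (fun=> 1%E) = 1%E)
  (dens_al : pE nu (f alpha) (fun=> 1%E) = 1%E)
  (int_th : nu.-integrable setT (fun x => (f th x * u x)%:E))
  (int_al : nu.-integrable setT (fun x => (f alpha x * u x)%:E))
  (mu_th : mth%:E = pE nu (f th) (fun x => (u x)%:E))
  (mu_al : z%:E = pE nu (f alpha) (fun x => (u x)%:E)).

Let c := eta th - eta alpha.
Let r := rho eta zeta th z alpha.
Let Y x := u x - z.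
(** This is the likelihood ratio of [th] to [alpha] as a function of the centred step. The factor 1
    gives it the shape required by [walk_tilt] over the weight 1. *)
Let g y := 1 * expR (c * y + r).
Local Notation Pr n t := (iidE nu (f t) n (fun xs => ind (smean u xs <= z))).

Let f0 t x : 0 <= f t x. Proof. by rewrite mulr_ge0 ?expR_ge0. Qed.

Let mf t : measurable_fun [set: mR] (f t : mR -> R).
Proof.
apply: measurable_funM => //; apply: measurableT_comp => //.
by apply: measurable_funB => //; exact: measurable_funM.
Qed.

Let mY : measurable_fun [set: mR] (Y : mR -> mR).
Proof. exact: measurable_funB. Qed.

Let m : probability mR R := law (mf alpha) (f0 alpha) dens_al mY.

Let g0 y : 0 <= g y. Proof. by rewrite mulr_ge0 ?expR_ge0. Qed.

Let mg : measurable_fun [set: mR] (g : mR -> R).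
Proof.
apply: measurable_funM => //; apply: measurableT_comp => //.
by apply: measurable_funD => //; exact: measurable_funM.
Qed.

Let f_th : f th = (fun x => f alpha x * g (Y x)).
Proof.
apply/funext => x; rewrite /expfam /g mul1r -mulrA -expRD; congr (_ * expR _).
by rewrite /c /r /rho /Y; ring.
Qed.

Let h (s : R) : \bar R := ind (s <= 0).

Let mh : measurable_fun [set: mR] (h : mR -> _).
Proof. exact: measurable_le_cst. Qed.

Let h0 s : (0 <= h s)%E. Proof. exact: ind_ge0. Qed.

Let sum_centered n (xs : seq R) : (0 < n)%N -> size xs = n ->
  ind (smean u xs <= z) = h (0 + \sum_(x <- xs) Y x).
Proof.
move=> n0 xsn; rewrite /h add0r; congr (ind _).
rewrite /smean xsn ler_pdivrMr ?ltr0n// /Y sumrB -subr_le0.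
by rewrite [\sum_(_ <- _) z]big_const_seq count_predT xsn iter_addr_0 mulr_natr.
Qed.

Let Pr_th n : (0 < n)%N -> Pr n th = walk m g n h 0.
Proof.
move=> n0; rewrite (eq_iidE nu _ n _ _ (fun xs => sum_centered n xs n0)).
by rewrite f_th iidE_walk_law.
Qed.

Let Pr_al n : (0 < n)%N -> Pr n alpha = walk m (fun=> 1) n h 0.
Proof.
move=> n0; rewrite (eq_iidE nu _ n _ _ (fun xs => sum_centered n xs n0)).
rewrite -(iidE_walk_law nu (f alpha) Y)//.
by congr iidE; apply/funext => x; rewrite mulr1.
Qed.

Let tilted n h' : measurable_fun [set: mR] (h' : mR -> \bar R) ->
  (forall s, 0 <= h' s)%E ->
  (walk m g n h' 0 =
   (expR (n%:R * r))%:E * walk m (fun=> 1%R) n (fun s => (expR (c * s))%:E * h' s) 0)%E.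
Proof. by move=> mh' h'0; rewrite /g walk_tilt// mulr0 subr0. Qed.

Let mexph : measurable_fun [set: mR] (fun s : mR => (expR (c * s))%:E * h s)%E.
Proof.
apply: emeasurable_funM => //; apply/measurable_EFinP.
by apply: measurableT_comp => //; exact: measurable_funM.
Qed.

Lemma tail_le_tilt n : eta alpha <= eta th -> (0 < n)%N ->
  (Pr n th <= (expR (n%:R * r))%:E * Pr n alpha)%E.
Proof.
move=> ce n0; rewrite Pr_th// Pr_al// tilted//.
apply: lee_wpmul2l; first by rewrite lee_fin expR_ge0.
apply: le_walk => //.
- by move=> s; rewrite mule_ge0// lee_fin expR_ge0.
- move=> s; rewrite /h /ind; have [s0|s0] := leP s 0; last first.
    by rewrite mulr0n mule0.
  rewrite mulr1n mule1 lee_fin -[leRHS]expR0 ler_expR.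
  by apply: mulr_ge0_le0 => //; rewrite subr_ge0.
Qed.

Let integrable_dens t : pE nu (f t) (fun=> 1%E) = 1%E ->
  nu.-integrable setT (EFin \o f t).
Proof.
move=> d; apply/integrableP; split; first exact/measurable_EFinP.
rewrite (_ : (\int[nu]_x _ = 1)%E) ?ltry// -[RHS]d.
by apply: eq_integral => x _; rewrite /= ger0_norm// mule1.
Qed.

Let Rint_dens t : pE nu (f t) (fun=> 1%E) = 1%E -> \int[nu]_x f t x = 1.
Proof.
move=> d; rewrite /Rintegral (_ : (\int[nu]_x _ = 1)%E)// -[RHS]d.
by apply: eq_integral => x _; rewrite mule1.
Qed.

Let int_centered : nu.-integrable setT (fun x => (f alpha x * Y x)%:E).
Proof.
have -> : (fun x => (f alpha x * Y x)%:E) =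
    (fun x => (f alpha x * u x)%:E + (- z)%:E * (EFin \o f alpha) x)%E.
  by apply/funext => x; rewrite /= /Y -EFinM -EFinD; congr EFin; ring.
apply: integrableD => //; apply: integrableZl => //.
exact: integrable_dens.
Qed.

Let intm : m.-integrable setT (EFin \o (idfun : R -> R)).
Proof.
have mid : measurable_fun [set: mR] (idfun : mR -> R) by exact: measurable_id.
exact: (integrable_law nu (f alpha) Y _ _ _ _ idfun mid int_centered).
Qed.

Let mean0 : (\int[m]_y y%:E = 0)%E.
Proof.
have mid : measurable_fun [set: mR] (idfun : mR -> R) by exact: measurable_id.
rewrite (integral_law_EFin nu (f alpha) Y _ _ _ _ idfun mid)/=.
have -> : (fun x => (f alpha x * Y x)%:E) =
    (fun x => (f alpha x * u x)%:E + (- z)%:E * (EFin \o f alpha) x)%E.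
  by apply/funext => x; rewrite /= /Y -EFinM -EFinD; congr EFin; ring.
have id := integrable_dens _ dens_al.
rewrite integralD//=; last exact: (integrableZl measurableT _ id).
rewrite (integralZl measurableT id).
rewrite (_ : (\int[nu]_x _ = z%:E)%E); last first.
  by rewrite mu_al; apply: eq_integral => x _; rewrite EFinM.
rewrite (_ : (\int[nu]_x _ = 1)%E); last first.
  by rewrite -dens_al; apply: eq_integral => x _; rewrite mule1.
by rewrite mule1 -EFinD subrr.
Qed.

Lemma tilt_tail_le_half n : (0 < n)%N ->
  ((expR (n%:R * r))%:E * Pr n alpha <=
     ((1 / 2 + Delta nu (f alpha) u z C n) * expR (n%:R * r))%:E)%E.
Proof.
move=> n0; rewrite Pr_al// EFinM muleC.
apply: lee_wpmul2r; first by rewrite lee_fin expR_ge0.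
rewrite (Delta_law _ _ _ _ _ (mf alpha) (f0 alpha) dens_al mY).
exact: walk_le0_half.
Qed.

Let integral_g : (\int[m]_y (g y)%:E = 1%:E)%E.
Proof.
rewrite integral_law//=.
- by rewrite -[RHS]dens_th f_th; apply: eq_integral => x _; rewrite mule1 EFinM.
- exact/measurable_EFinP.
Qed.

(* Integrating [1 + t <= exp t] against the density at [th]. *)
Let rho_ge : - c * (mth - z) <= r.
Proof.
have id := integrable_dens _ dens_th.
have i1 := integrableZl measurableT (1 + c * z - r) id.
have i2 := integrableZl measurableT (- c) int_th.
have int : nu.-integrable setT
    (EFin \o (fun x => (1 + c * z - r) * f th x + - c * (f th x * u x))).
  exact: (integrableD measurableT i1 i2).
have : \int[nu]_x ((1 + c * z - r) * f th x + - c * (f th x * u x)) <=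
    \int[nu]_x f alpha x.
  apply: le_Rintegral => //; first exact: integrable_dens.
  move=> x _; have -> : f alpha x = f th x * expR (- (c * Y x + r)).
    by rewrite f_th /g mul1r -mulrA -expRD subrr expR0 mulr1.
  rewrite [leLHS](_ : _ = f th x * (1 + - (c * Y x + r))); last by rewrite /Y; ring.
  by rewrite ler_wpM2l// expR_ge1Dx.
(* Both densities integrate to 1, so the inequality becomes [1 + c * z - r - c * mth <= 1]. *)
rewrite (Rint_dens _ dens_al) RintegralD// !RintegralZl// (Rint_dens _ dens_th).
rewrite (_ : \int[nu]_x (f th x * u x) = mth); first by lra.
by rewrite /Rintegral (_ : (\int[nu]_x _)%E = mth%:E).
Qed.

Lemma tail_le_exp n : z <= mth -> (0 < n)%N ->
  (Pr n th <= (expR (n%:R * r))%:E)%E.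
Proof.
move=> zm n0; have [ce|ce] := leP (eta alpha) (eta th).
  apply: le_trans (tail_le_tilt _ ce n0) _.
  rewrite -[leRHS]mule1 lee_wpmul2l ?lee_fin ?expR_ge0//.
  rewrite Pr_al//; apply: walk_le1 => // s.
  by rewrite h0 lee_fin lern1 leq_b1.
have r0 : 0 <= r.
  apply: le_trans rho_ge; rewrite mulr_ge0 ?subr_ge0//.
  by rewrite oppr_ge0 subr_le0 ltW.
apply: (@le_trans _ _ 1%E); last first.
  by rewrite lee_fin -expR0 ler_expR mulr_ge0.
rewrite Pr_th// -[leRHS](_ : walk m g n (fun=> 1%E) 0 = 1%E); last first.
  by rewrite (walk_cst m g mg g0 n 1)// expr1n.
by apply: le_walk => // t; rewrite /h lee_fin lern1 leq_b1.
Qed.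

Hypothesis pos : (0 < pE nu (f th) (fun x => ind (z < u x)%R))%E.

(** The hypothesis concerns [th], the window bound needs [alpha]. A set null under the law at
    [alpha] stays null after multiplication by the density [g], so positivity carries over. *)
Let pos_m : (0 < \int[m]_y ind (0 < y)%R)%E.
Proof.
have mI := @measurable_gt0 R.
have I_ge0 : (0 <= \int[m]_y ind (0 < y)%R)%E.
  by apply: integral_ge0 => y _; exact: ind_ge0.
rewrite lt_neqAle I_ge0 andbT; apply/eqP => I0.
move: pos; rewrite f_th.
have -> : pE nu (fun x => f alpha x * g (Y x)) (fun x => ind (z < u x)%R) =
    (\int[m]_y ((g y)%:E * ind (0 < y)%R))%E.
  rewrite integral_law//=.
  - by apply: eq_integral => x _; rewrite muleA EFinM /Y subr_gt0.
  - by apply: emeasurable_funM => //; exact/measurable_EFinP.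
  - by move=> y; rewrite mule_ge0 ?lee_fin.
have /ae_eq_integral_abs : (\int[m]_y `|ind (0 < y)%R| = 0)%E.
  by rewrite [RHS]I0; apply: eq_integral => y _; rewrite gee0_abs// ind_ge0.
move=> /(_ measurableT mI) ae0.
rewrite (_ : (\int[m]_y _ = 0)%E) ?ltxx//.
rewrite -[RHS](@integral0 _ _ _ m setT); apply: ae_eq_integral => //.
  by apply: emeasurable_funM => //; exact/measurable_EFinP.
by apply: filterS ae0 => y /[apply] ->; rewrite mule0.
Qed.

Lemma near_tail_ge_exp (e : R) : 0 < e ->
  \forall n \near \oo, ((expR (n%:R * (r - e)))%:E <= Pr n th)%E.
Proof.
(* Half of [e] pays for the window probability, the other half for the tilt on the window; adding 1
   to [|c|] covers the case [c = 0]. *)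
move=> e0; pose eps := e / (2 * (`|c| + 1)).
have c1 : 0 < `|c| + 1 by rewrite ltr_wpDl.
have eps0 : 0 < eps by rewrite divr_gt0// mulr_gt0.
have ceps : `|c| * eps <= e / 2.
  have : (`|c| + 1) * eps = e / 2 by rewrite /eps; field; rewrite gt_eqF.
  by lra.
have e20 : 0 < e / 2 by lra.
near=> n.
have n0 : (0 < n)%N by near: n; exact: nbhs_infty_gt.
have W : ((expR (- (n%:R * (e / 2))))%:E <= walk m (fun=> 1%R) n (window eps n) 0%R)%E.
  by near: n; exact: (near_walk_window m intm mean0 pos_m).
rewrite Pr_th// tilted//.
rewrite (_ : n%:R * (r - e) = n%:R * r + (- (n%:R * (e / 2)) + - (n%:R * (e / 2)))); last by field.
rewrite expRD EFinM; apply: lee_wpmul2l; first by rewrite lee_fin expR_ge0.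
rewrite expRD EFinM.
apply: (@le_trans _ _ ((expR (- (n%:R * (e / 2))))%:E *
    walk m (fun=> 1%R) n (window eps n) 0)%E).
  by apply: lee_wpmul2l => //; rewrite lee_fin expR_ge0.
have m1 : measurable_fun [set: mR] ((fun=> 1) : mR -> R) by [].
have g01 (y : R) : 0 <= (1 : R) <= 1 by rewrite ler01 lexx.
rewrite -(walkZl m _ m1 g01) ?expR_ge0//; last 2 first.
- exact: measurable_window.
- by move=> s; exact: ind_ge0.
apply: le_walk => //.
- by apply: emeasurable_funM => //; exact: measurable_window.
- by move=> s; rewrite mule_ge0 ?ind_ge0.
(* Off the window the left side is zero; on it [|c * s| <= n%:R * (|c| * eps) <= n%:R * (e / 2)]. *)
- move=> s; rewrite /window /h; have [|_] /= := boolP (_ && _); last first.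
    by rewrite mule0 mule_ge0// ind_ge0.
  move=> /andP[sn s0]; rewrite s0 !mule1 lee_fin ler_expR.
  have sE : `|s| <= n%:R * eps by rewrite ler0_norm// lerNl.
  rewrite lerNl (le_trans (ler_norm _))// normrN normrM.
  apply: (@le_trans _ _ (n%:R * (`|c| * eps))); last by rewrite ler_wpM2l.
  by rewrite mulrCA ler_wpM2l.
Unshelve. all: by end_near.
Qed.

Lemma tail_rate : z <= mth ->
  (fun n : nat => n%:R^-1 * ln (fine (Pr n th))) @ \oo --> r.
Proof.
move=> zm; apply/cvgrPdist_le => e e0; near=> n.
have n0 : (0 < n)%N by near: n; exact: nbhs_infty_gt.
have lo : ((expR (n%:R * (r - e)))%:E <= Pr n th)%E.
  by near: n; exact: near_tail_ge_exp.
have up := tail_le_exp _ zm n0.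
(* The two bounds force the probability to be finite and positive, so neither [fine] nor [ln] takes
   a default value. *)
move: lo up; case: (Pr n th) => [x| |]//; rewrite !lee_fin /= => lo up.
have x0 : 0 < x by apply: lt_le_trans lo; exact: expR_gt0.
have n0' : 0 < n%:R :> R by rewrite ltr0n.
have lo' : n%:R * (r - e) <= ln x by rewrite -[leLHS]expRK ler_ln ?posrE ?expR_gt0.
have up' : ln x <= n%:R * r by rewrite -[leRHS]expRK ler_ln ?posrE ?expR_gt0.
rewrite ler_distlC mulrC ler_pdivlMr// ler_pdivrMr//.
rewrite mulrC lo' /= (le_trans up')// mulrC ler_pM2r//.
by lra.
Unshelve. all: by end_near.
Qed.

End one_sided.

(** * Exchange of upper and lower tails by a change of signs *)

Section reflection.
Context {R : realType}.
Local Notation mR := (measurableTypeR R).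
Implicit Types u v eta zeta : R -> R.

(** Only the product of [eta] and [u] enters the density. The reflected data thus describe the same
    distributions, while upper tails of [u] become lower tails and the order of the [eta] values is
    reversed. *)
Lemma expfamNN u v eta zeta :
  expfam (fun x => - u x) v (fun t => - eta t) zeta = expfam u v eta zeta.
Proof. by apply/funext => t; apply/funext => x; rewrite /expfam mulrNN. Qed.

Lemma smeanN u xs : smean (fun x => - u x) xs = - smean u xs.
Proof. by rewrite /smean sumrN mulNr. Qed.

Lemma rhoNN eta zeta th z alpha :
  rho (fun t => - eta t) zeta th (- z) alpha = rho eta zeta th z alpha.
Proof. by rewrite /rho; ring. Qed.

Lemma DeltaNN (nu : {measure set mR -> \bar R}) p u (z C : R) n :
  Delta nu p (fun x => - u x) (- z) C n = Delta nu p u z C n.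
Proof.
have E k : (fun x => (`|- u x - - z| ^+ k)%:E) = (fun x => (`|u x - z| ^+ k)%:E).
  by apply/funext => x; rewrite -opprD normrN.
by rewrite /Delta !E.
Qed.

End reflection.

Theorem theorem5 (R : realType)
  (nu : {measure set (measurableTypeR R) -> \bar R})
  (Theta : set R) (u v eta zeta mu : R -> R) (C : R)
  (* base measure: Lebesgue (pdf case) or counting (pmf case) *)
  (Hnu : (forall A, measurable A -> nu A = (@lebesgue_measure R) A)
         \/ (forall A, nu A = counting A))
  (Hu : measurable_fun setT u) (Hv : measurable_fun setT v)
  (Hv0 : forall x, 0 <= v x)
  (Hdens : forall th, Theta th -> pE nu (expfam u v eta zeta th) (fun=> 1%E) = 1%E)
  (Heta : forall th, Theta th -> derivable eta th 1)
  (Hzeta : forall th, Theta th -> derivable zeta th 1)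
  (Hint : forall th, Theta th ->
     nu.-integrable setT (fun x => ((expfam u v eta zeta th x) * u x)%:E))
  (Hmu : forall th, Theta th ->
     (mu th)%:E = pE nu (expfam u v eta zeta th) (fun x => (u x)%:E))
  (HC : BerryEsseen_const C)
  (th alpha : R) (Hth : Theta th) (Halpha : Theta alpha) :
  let z := mu alpha in
  let f := expfam u v eta zeta in
  let PrZge n t := iidE nu (f t) n (fun xs => ind (z <= smean u xs)) in
  let PrZle n t := iidE nu (f t) n (fun xs => ind (smean u xs <= z)) in
  let r := rho eta zeta th z alpha in
  (* (I) *)
  (mu th <= z -> (0 < pE nu (f th) (fun x => ind (u x < z)%R))%E ->
     (forall n, (0 < n)%N -> (PrZge n th <= (expR (n%:R * r))%:E)%E) /\
     ((fun n : nat => (n%:R)^-1 * ln (fine (PrZge n th))) @ \oo --> r)) /\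
  (* (II) *)
  (z <= mu th -> (0 < pE nu (f th) (fun x => ind (z < u x)%R))%E ->
     (forall n, (0 < n)%N -> (PrZle n th <= (expR (n%:R * r))%:E)%E) /\
     ((fun n : nat => (n%:R)^-1 * ln (fine (PrZle n th))) @ \oo --> r)) /\
  (* (III) *)
  (eta th <= eta alpha -> forall n, (0 < n)%N ->
     (PrZge n th <= (expR (n%:R * r))%:E * PrZge n alpha)%E /\
     ((expR (n%:R * r))%:E * PrZge n alpha
        <= ((1/2 + Delta nu (f alpha) u z C n) * expR (n%:R * r))%:E)%E) /\
  (* (IV) *)
  (eta alpha <= eta th -> forall n, (0 < n)%N ->
     (PrZle n th <= (expR (n%:R * r))%:E * PrZle n alpha)%E /\
     ((expR (n%:R * r))%:E * PrZle n alpha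
        <= ((1/2 + Delta nu (f alpha) u z C n) * expR (n%:R * r))%:E)%E).
Proof.
move=> z f PrZge PrZle r.
have dth := Hdens th Hth; have dal := Hdens alpha Halpha.
have ith := Hint th Hth; have ial := Hint alpha Halpha.
have mth := Hmu th Hth; have mal := Hmu alpha Halpha.
have HuN : measurable_fun setT (fun x => - u x) by exact: measurable_funN.
have iN t : Theta t ->
    nu.-integrable setT (fun x => (f t x * - u x)%:E).
  move=> Tt; under eq_fun do rewrite mulrN EFinN.
  by apply: integrableN; exact: Hint.
have mN t : Theta t -> (- mu t)%:E = pE nu (f t) (fun x => (- u x)%:E).
  move=> Tt; rewrite EFinN Hmu//; have iu := Hint t Tt.
  rewrite -mulN1e -EFinN -(integralZl measurableT iu).
  by apply: eq_integral => x _; rewrite /f -!EFinM; congr EFin; ring.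
(* The upper tail at [z] is the lower tail at [- z] of the reflected family, to which the one-sided
   results apply. *)
have geN n t : PrZge n t =
    iidE nu (expfam (fun x => - u x) v (fun t => - eta t) zeta t) n
      (fun xs => ind (smean (fun x => - u x) xs <= - z)).
  rewrite expfamNN; congr iidE; apply/funext => xs.
  by rewrite smeanN lerN2.
have rN : r = rho (fun t => - eta t) zeta th (- z) alpha by rewrite rhoNN.
split; [|split; [|split]].
(* For the reflected family the means are [- mu th] and [- z], so [mu th <= z] turns into the order
   required for a lower tail. *)
- move=> mz pos; rewrite rN; split.
  + move=> n n0; rewrite geN.
    by apply: (@tail_le_exp _ _ _ _ _ _ _ _ _ _ _ (- mu th));
      rewrite ?expfamNN ?lerN2//; [exact: iN|exact: mN].
  + under eq_fun do rewrite geN.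
    apply: (@tail_rate _ _ _ _ _ _ _ _ _ _ _ (- mu th));
      rewrite ?expfamNN ?lerN2//; try exact: iN; try exact: mN.
    by under eq_fun do rewrite ltrN2.
- move=> zm pos; split=> [n n0|].
  + exact: (@tail_le_exp _ _ _ _ _ _ _ _ _ _ _ (mu th)).
  + exact: (@tail_rate _ _ _ _ _ _ _ _ _ _ _ (mu th)).
- move=> ee n n0; rewrite !geN rN; split.
  + by apply: tail_le_tilt => //; rewrite ?expfamNN ?lerN2.
  + rewrite -DeltaNN -[f]expfamNN.
    by apply: tilt_tail_le_half; rewrite ?expfamNN//; [exact: iN|exact: mN].
- move=> ee n n0; split; first exact: tail_le_tilt.
  exact: tilt_tail_le_half.
Qed.
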